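(* Let $d\ge 1$ and let $P$ be a monic real polynomial of degree $d$. Then: (1) for every integer $r$, $\rho_{d,r}(P)\le \rho_{d-1,r}(P'/d)\le \rho_{d,r+1}(P)$ (in $\mathbb{R}\cup\{\pm\infty\}$); (2) $P$ has $d$ virtual roots $\rho_{d,1}(P),\dots,\rho_{d,d}(P)\in\mathbb{R}$ (possibly equal); (3) for every integer $r$ and every $x\in U_{d,r+1}(P)$, $(-1)^{d+r}P(x)>0$.
   Context: For $d\ge 1$, write a monic real polynomial of degree $d$ as $P=x^d-(a_{d-1}x^{d-1}+\dots+a_0)$. Function $\mathcal{R}_d$. For reals $a\le b$ and $P$ monic of degree $d\geq 1$ with $P'(x)P'(y)\ge 0$ for all $x,y\in[a,b]$, $\mathcal{R}_d(a,b,P)$ denotes the (unique) $z\in[a,b]$ such that $|P(z)|=\min\{|P(u)|:u\in[a,b]\}$. Put $m(P)=1+\max_{0\le i\le d-1}|a_i|$. If $P'\ge 0$ on $[a,+\infty)$, then $\mathcal{R}_d(a,+\infty,P)=\mathcal{R}_d(a,\max(a,m(P)),P)$. If $(-1)^{d-1}P'\ge 0$ on $(-\infty,b]$, then $\mathcal{R}_d(-\infty,b,P)=\mathcal{R}_d(\min(b,-m(P)),b,P)$. Virtual roots. For $d\ge 0$ and any integer $j$: $\rho_{d,j}(P)=-\infty$ if $j\le 0$; $\rho_{d,j}(P)=+\infty$ if $j>d$; $\rho_{1,1}(x-a)=a$; and for $d\ge 2$, $1\le j\le d$, inductively $\rho_{d,j}(P)=\mathcal{R}_d(\rho_{d-1,j-1}(P'/d),\rho_{d-1,j}(P'/d),P)$.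 (That the arguments always lie in the domain of definition of $\mathcal{R}_d$ is established along the same induction.) The virtual roots of $P$ are the $\rho_{d,j}(P)$, $1\le j\le d$. For any integer $j$, $U_{d,j}(P)=\{\alpha\in\mathbb{R}:\rho_{d,j-1}(P)<\alpha<\rho_{d,j}(P)\}$ (possibly empty). *)

(* Defs.v *)
From mathcomp Require Import all_boot all_order all_algebra.
From mathcomp Require Import all_classical all_reals all_analysis.

Set Implicit Arguments.
Unset Strict Implicit.
Unset Printing Implicit Defensive.

Import Order.TTheory GRing.Theory Num.Theory.

Local Open Scope classical_set_scope.
Local Open Scope ring_scope.

Section VirtualRoots.
Variable R : realType.
Implicit Types (d : nat) (j : int) (P : {poly R}).

(** For [P = 'X^d - (a_(d-1) 'X^(d-1) + ... + a_0)] one has [a_i = - P`_i];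
    the neutral element [0] of the iterated maximum is harmless, since all the
    terms are nonnegative. *)
Definition root_bound d P : R :=
  1 + \big[Num.max/0]_(i < d) `| - P`_i |.

Definition calR_dom d (a b : R) P : Prop :=
  [/\ (0 < d)%N, P \is monic, size P = d.+1, a <= b &
      forall x y, x \in `[a, b] -> y \in `[a, b] ->
        0 <= P^`().[x] * P^`().[y]].

Definition min_abs_at (a b : R) P (z : R) : Prop :=
  z \in `[a, b] /\ forall u, u \in `[a, b] -> `|P.[z]| <= `|P.[u]|.

(** [calR] and [calR_fin] are partial functions. Where the value is undefined
    (arguments outside of the domain, or no unique minimizer) they return the
    junk value [-oo], which is not a real number: a finite value thus certifies
    that the arguments are in the domain of definition. *)
Definition calR_fin d (a b : R) P : \bar R :=
  xget -oo%E [set z%:E | z in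
    [set z | calR_dom d a b P /\ unique (min_abs_at a b P) z]].

Definition calR d (a b : \bar R) P : \bar R :=
  match a, b with
  | EFin a', EFin b' => calR_fin d a' b' P
  | EFin a', +oo%E =>
      if `[< forall x, a' <= x -> 0 <= P^`().[x] >]
      then calR_fin d a' (Num.max a' (root_bound d P)) P
      else -oo%E
  | -oo%E, EFin b' =>
      if `[< forall x, x <= b' -> 0 <= (-1) ^+ d.-1 * P^`().[x] >]
      then calR_fin d (Num.min b' (- root_bound d P)) b' P
      else -oo%E
  | _, _ => -oo%E
  end.

Definition monic_deriv d P : {poly R} := d%:R^-1 *: P^`().

(** The outer branch [d = 0] is unreachable after the two tests on [j]. For
    [d = 1], the value at [P = 'X - a%:P] is [a = - P`_0]. *)
Fixpoint vroot d j P : \bar R :=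
  if j <= 0 then -oo%E
  else if d%:Z < j then +oo%E
  else match d with
       | 0 => -oo%E
       | 1 => (- P`_0)%:E
       | d'.+1 =>
           calR d (vroot d' (j - 1) (monic_deriv d P))
                  (vroot d' j (monic_deriv d P)) P
       end.

Definition vroot_gap d j P : set R :=
  [set x | (vroot d (j - 1) P < x%:E < vroot d j P)%E].

End VirtualRoots.

(* Main.v *)
Require Import Defs.
From mathcomp Require Import all_boot all_order all_algebra.
From mathcomp Require Import all_classical all_reals all_analysis.
From mathcomp Require Import zify ring lra.

Import Order.TTheory GRing.Theory Num.Theory.
Import numFieldNormedType.Exports.

Local Open Scope classical_set_scope.
Local Open Scope ring_scope.

(** Everything follows from one induction on the degree [d], whose hypothesis
    says that the virtual roots are finite, nondecreasing in their index, and
    cut the line into open gaps on each of which [P] has a known strict sign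
    ([vroots_split_sign]).

    Suppose this holds for [Q = P' / (d + 1)]. On the [k]-th gap of [Q] the
    derivative of [P] has the sign of [(-1) ^ (d + k)], so [(-1) ^ (d + k) P]
    is strictly increasing on the closure of the gap. Let [z] minimize the
    absolute value of a strictly increasing function on an interval. The
    function must be negative to the left of [z]: a nonnegative value there
    would be strictly smaller than the value at [z], and would beat the minimum.
    Symmetrically it is positive to the right of [z] ([min_abs_incr]). No case
    distinction is needed according to whether [z] is a root or an endpoint.
    Existence of [z] is the extreme value theorem; uniqueness follows from the
    two signs, which are incompatible between two minimizers. On the two
    unbounded gaps, where the minimum is taken over a bounded part only, the
    sign on the rest is given by the Cauchy bound on the roots. This is the
    content of [calR_split_sign].

    Therefore each virtual root [z] of [P] lies in the closure of a gap of [Q],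
    which is the interlacing property and the monotonicity in the index, and
    [P] has known signs on both sides of [z] within this closure. A gap of [P]
    meets at most two consecutive closed gaps of [Q], separated by a virtual
    root of [Q]: the part on the left of this separation is to the right of a
    minimizer, the part on the right of it is to the left of the next minimizer,
    and the parities are such that the two signs agree. *)

(** * Signs and monotonicity of real polynomials *)

(** This gives the weak sign of the derivative at the end points of a gap, which
    the domain of [calR] requires. A negative value at an end point would force
    a root inside the interval, by the intermediate value theorem. *)
Lemma horner_ge0_itv (R : realType) (p : {poly R}) (a b : R) :
    a < b -> (forall x, a < x < b -> 0 < p.[x]) ->
  forall x, a <= x <= b -> 0 <= p.[x].
Proof.
move=> ab p_gt0 x /andP[ax xb]; rewrite leNgt; apply/negP => px_lt0.
pose y := (a + b) / 2.
have y_ab : a < y < b by rewrite /y; lra.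
have py_gt0 := p_gt0 y y_ab; move: y_ab => /andP[ay yb].
have [xy|yx] := leP x y.
- have [|w /andP[xw wy] /rootP w0] := @poly_ivt _ p _ _ xy; first lra.
  have xNw : x != w by apply/eqP => xw'; rewrite xw' w0 ltxx in px_lt0.
  have := p_gt0 w; lra.
- have [|w /andP[yw wx]] := @poly_ivt _ (- p) _ _ (ltW yx).
    by rewrite !hornerN; lra.
  rewrite /root hornerN oppr_eq0 => /eqP w0.
  have wNx : w != x by apply/eqP => wx'; rewrite -wx' w0 ltxx in px_lt0.
  have := p_gt0 w; lra.
Qed.

Lemma horner_incr (R : realType) (p : {poly R}) (a b : R) :
    (forall x, a < x < b -> 0 < p^`().[x]) ->
  forall x y, a <= x -> x < y -> y <= b -> p.[x] < p.[y].
Proof.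
move=> dp_gt0; apply: (@gtr0_derive1_incr R (horner p) a b).
- by move=> x _; exact: derivable_horner.
- by move=> x; rewrite in_itv /= -derivE => /dp_gt0.
- exact/continuous_subspaceT/continuous_horner.
Qed.

(** With [m = root_bound d P], the lower coefficients are at most [m - 1] in
    absolute value, hence at most [`|x| - 1], and
    [(`|x| - 1) * (1 + `|x| + ... + `|x| ^ (d - 1))] telescopes to
    [`|x| ^ d - 1]. *)
Lemma horner_cauchy_bound (R : realType) (d : nat) (P : {poly R}) (x : R) :
    P \is monic -> size P = d.+1 -> root_bound d P <= `|x| ->
  `|P.[x] - x ^+ d| < `|x| ^+ d.
Proof.
move=> P_monic P_size; rewrite /root_bound; set M := \big[_/_]_(i < d) _ => xM.
have lead1 : P`_d = 1 by move/monicP: P_monic; rewrite /lead_coef P_size.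
rewrite horner_coef P_size big_ord_recr /= lead1 mul1r addrK.
apply: (le_lt_trans (ler_norm_sum _ _ _)).
apply: (@le_lt_trans _ _ ((`|x| - 1) * \sum_(i < d) `|x| ^+ i)).
  rewrite mulr_sumr; apply: ler_sum => i _.
  rewrite normrM normrX ler_wpM2r ?exprn_ge0 //.
  rewrite lerBrDl; apply: le_trans xM; rewrite lerD2l.
  by rewrite -normrN; exact: (le_bigmax _ (fun i : 'I_d => `| - P`_i|)).
by rewrite -subrX1 ltrBlDr ltrDl.
Qed.

Lemma root_bound_ge0 (R : realType) (d : nat) (P : {poly R}) :
  0 <= root_bound d P.
Proof. by rewrite addr_ge0 // bigmax_ge_id. Qed.

Lemma horner_gt_root_bound (R : realType) (d : nat) (P : {poly R}) (x : R) :
    P \is monic -> size P = d.+1 -> root_bound d P <= x -> 0 < P.[x].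
Proof.
move=> P_monic P_size mx; have x_ge0 := le_trans (root_bound_ge0 _ d P) mx.
have := @horner_cauchy_bound R d P x P_monic P_size.
by rewrite ger0_norm // => /(_ mx); rewrite ltr_distl; lra.
Qed.

Lemma horner_lt_root_bound (R : realType) (d : nat) (P : {poly R}) (x : R) :
    P \is monic -> size P = d.+1 -> x <= - root_bound d P ->
  0 < (-1) ^+ d * P.[x].
Proof.
move=> P_monic P_size xm; have m_ge0 := root_bound_ge0 _ d P.
have x_le0 : x <= 0 by lra.
have := @horner_cauchy_bound R d P x P_monic P_size.
rewrite ler0_norm // lerNr => /(_ xm).
rewrite (exprNn x) -signr_odd; case: (odd d);
  rewrite ?expr0 ?expr1 ltr_distl; lra.
Qed.

(** * The minimizer of the absolute value *)

(** If [x < z] and [0 <= Q x], then [0 <= Q x < Q z], so that [x] beats the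
    minimizer [z]; symmetrically on the right of [z]. *)
Lemma min_abs_incr (R : realType) (Q : R -> R) (a b z : R) :
    (forall x y, a <= x -> x < y -> y <= b -> Q x < Q y) ->
    a <= z <= b -> (forall u, a <= u <= b -> `|Q z| <= `|Q u|) ->
  (forall x, a <= x -> x < z -> Q x < 0) /\
  (forall x, x <= b -> z < x -> 0 < Q x).
Proof.
move=> Q_incr /andP[az zb] z_min; split=> x xab xz.
- have Qxz := Q_incr x z xab xz zb; rewrite ltNge; apply/negP => Qx_ge0.
  have := z_min x; rewrite !ger0_norm; lra.
- have Qzx := Q_incr z x az xz xab; rewrite ltNge; apply/negP => Qx_le0.
  have := z_min x; rewrite !ler0_norm; lra.
Qed.

Lemma sign_mulr_mulr (R : realType) (n : nat) (x y : R) :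
  ((-1) ^+ n * x) * ((-1) ^+ n * y) = x * y.
Proof. by rewrite mulrACA -expr2 sqrr_sign mul1r. Qed.

(** The sign [(-1) ^+ n] covers the increasing and the decreasing case at once.
    An empty open interval, where the hypothesis on the derivative is void, is
    allowed: it occurs when two consecutive virtual roots coincide. *)
Lemma calR_fin_split_sign (R : realType) (d n : nat) (a b : R) (P : {poly R}) :
    (0 < d)%N -> P \is monic -> size P = d.+1 -> a <= b ->
    (forall x, a < x < b -> 0 < (-1) ^+ n * P^`().[x]) ->
  exists z, [/\ calR_fin d a b P = z%:E, a <= z <= b,
    forall x, a <= x -> x < z -> (-1) ^+ n * P.[x] < 0 &
    forall x, x <= b -> z < x -> 0 < (-1) ^+ n * P.[x]].
Proof.
move=> d_gt0 P_monic P_size ab dP_gt0.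
pose Q := (-1) ^+ n *: P.
have QE (x : R) : Q.[x] = (-1) ^+ n * P.[x] by rewrite hornerZ.
have dQE (x : R) : Q^`().[x] = (-1) ^+ n * P^`().[x] by rewrite derivZ hornerZ.
have QP_norm (x : R) : `|Q.[x]| = `|P.[x]| by rewrite QE normrMsign.
have Q_incr : forall x y, a <= x -> x < y -> y <= b -> Q.[x] < Q.[y].
  by apply: horner_incr => x xab; rewrite dQE dP_gt0.
have split_sign z : min_abs_at a b P z ->
    (forall x, a <= x -> x < z -> Q.[x] < 0) /\
    (forall x, x <= b -> z < x -> 0 < Q.[x]).
  case; rewrite in_itv /= => zab z_min; apply: min_abs_incr => // u uab.
  by rewrite !QP_norm z_min // in_itv.
have min_uniq z1 z2 : min_abs_at a b P z1 -> min_abs_at a b P z2 -> z1 = z2.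
  (* At the midpoint of two minimizers [Q] would have both strict signs. *)
  move=> m1 m2.
  wlog z12 : z1 z2 m1 m2 / z1 < z2 => [wlog_lt|].
    by case: (ltgtP z1 z2) => // /wlog_lt ->.
  have [_ pos] := split_sign _ m1; have [neg _] := split_sign _ m2.
  move: m1 m2 => [+ _] [+ _]; rewrite !in_itv /= => m1 m2.
  have := pos ((z1 + z2) / 2); have := neg ((z1 + z2) / 2); lra.
have [z z_ab z_min] : exists2 c, c \in `[a, b] &
    forall t, t \in `[a, b] -> `|P.[c]| <= `|P.[t]|.
  apply: EVT_min => //; apply: continuous_subspaceT => x.
  apply: (@continuous_comp _ _ _ (horner P) Num.norm).
    exact: continuous_horner.
  exact: norm_continuous.
have zP : min_abs_at a b P z by [].
have dom : calR_dom d a b P.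
  split=> // x y; rewrite !in_itv /= => xab yab.
  move: ab; rewrite le_eqVlt => /predU1P[eab|ltab].
    (* Only the open interval carries a hypothesis, and it is empty here; the
       product to bound is then a square. *)
    by rewrite (_ : x = y) -?expr2 ?sqr_ge0 //; lra.
  rewrite -(sign_mulr_mulr _ n) -!dQE.
  by rewrite mulr_ge0 // (@horner_ge0_itv _ _ a b) // => t /dP_gt0;
     rewrite dQE.
exists z; split=> //.
- apply: xget_subset1 => [|_ _ [u [_ [um _]] <-] [v [_ [vm _]] <-]].
    by exists z => //; split=> //; split=> // z'; exact: min_uniq.
  by rewrite (min_uniq u v).
- by move=> x ax xz; rewrite -QE; apply: (proj1 (split_sign z zP)).
- by move=> x xb zx; rewrite -QE; apply: (proj2 (split_sign z zP)).
Qed.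

(** On an unbounded interval the sign of [P] beyond the root bound is forced by
    its degree, hence the two parity hypotheses on [n]: they make this sign
    agree with the sense of variation of [P]. *)
Lemma calR_split_sign (R : realType) (d n : nat) (a b : \bar R) (P : {poly R}) :
    (0 < d)%N -> P \is monic -> size P = d.+1 ->
    (a <= b)%E -> (a < +oo)%E -> (-oo < b)%E -> (-oo < a)%E || (b < +oo)%E ->
    (a = -oo%E -> odd n = odd d.-1) -> (b = +oo%E -> ~~ odd n) ->
    (forall x, (a < x%:E < b)%E -> 0 < (-1) ^+ n * P^`().[x]) ->
  exists z, [/\ calR d a b P = z%:E, (a <= z%:E <= b)%E,
    forall x, (a <= x%:E)%E -> x < z -> (-1) ^+ n * P.[x] < 0 &
    forall x, (x%:E <= b)%E -> z < x -> 0 < (-1) ^+ n * P.[x]].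
Proof.
move=> d_gt0 P_monic P_size; case: a b => [a| |] [b| |] //= ab _ _ _ n_a n_b dP.
- rewrite lee_fin in ab.
  have [|z [-> zab neg pos]] :=
    @calR_fin_split_sign R d n a b P d_gt0 P_monic P_size ab.
    by move=> x xab; apply: dP; rewrite !lte_fin.
  by exists z.
- have n_even : (-1) ^+ n = 1 :> R.
    by rewrite -signr_odd (negbTE (n_b erefl)).
  have {}dP x : a < x -> 0 < P^`().[x].
    by move=> ax; rewrite -[P^`().[x]]mul1r -n_even dP // lte_fin ax ltry.
  have [||z [zE /andP[az zb] neg pos]] :=
    @calR_fin_split_sign R d n a (Num.max a (root_bound d P)) P
      d_gt0 P_monic P_size.
  + by rewrite le_max lexx.
  + by move=> x /andP[ax _]; rewrite n_even mul1r dP.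
  rewrite zE asboolT; last first.
    move=> x ax; apply: (@horner_ge0_itv R _ a (x + 1)); last by lra.
      by lra.
    by move=> y /andP[/dP].
  exists z; split=> //; first by rewrite lee_fin az leey.
  move=> x _ zx; case: (leP x (Num.max a (root_bound d P))) => [/pos|];
    first exact.
  rewrite gt_max => /andP[_ mx]; rewrite n_even mul1r.
  exact: horner_gt_root_bound P_monic P_size (ltW mx).
- have n_par : (-1) ^+ n = (-1) ^+ d.-1 :> R.
    by rewrite -signr_odd n_a // signr_odd.
  have {}dP x : x < b -> 0 < (-1) ^+ n * P^`().[x].
    by move=> xb; rewrite dP // lte_fin xb ltNyr.
  have [||z [zE /andP[az zb] neg pos]] :=
    @calR_fin_split_sign R d n (Num.min b (- root_bound d P)) b P
      d_gt0 P_monic P_size.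
  + by rewrite ge_min lexx.
  + by move=> x /andP[_ xb]; exact: dP.
  rewrite zE asboolT; last first.
    move=> x xb; rewrite -n_par -hornerZ.
    apply: (@horner_ge0_itv R _ (x - 1) b); last by lra.
      by lra.
    by move=> y /andP[_ /dP]; rewrite hornerZ.
  exists z; split=> //; first by rewrite lee_fin zb leNye.
  move=> x _ xz; case: (leP (Num.min b (- root_bound d P)) x) => [/neg|];
    first exact.
  rewrite lt_min => /andP[_ mx].
  have := @horner_lt_root_bound R d P x P_monic P_size (ltW mx).
  by rewrite n_par -{1}(prednK d_gt0) exprS mulN1r mulNr oppr_gt0.
Qed.

(** * Virtual roots *)

Section VirtualRootsTheory.
Variable R : realType.
Implicit Types (d k : nat) (P : {poly R}).

Lemma vroot_le0 d (j : int) P : j <= 0 -> vroot d j P = -oo%E.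
Proof. by case: d => [|d] /= ->. Qed.

Lemma vroot_gtd d (j : int) P : d%:Z < j -> vroot d j P = +oo%E.
Proof.
move=> dj; have j_gt0 : (j <= 0) = false by lia.
by case: d dj => [|d] /= dj; rewrite j_gt0 dj.
Qed.

Lemma vrootS d k P : (0 < d)%N -> (k <= d)%N ->
  vroot d.+1 k.+1 P = calR d.+1 (vroot d k (monic_deriv d.+1 P))
                                (vroot d k.+1 (monic_deriv d.+1 P)) P.
Proof.
move=> d_gt0 kd; case: d d_gt0 kd => // d _ kd.
have -> : vroot d.+2 k.+1 P = if d.+2%:Z < k.+1%:Z then +oo%E else
    calR d.+2 (vroot d.+1 (k.+1%:Z - 1) (monic_deriv d.+2 P))
              (vroot d.+1 k.+1 (monic_deriv d.+2 P)) P by [].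
have -> : (d.+2%:Z < k.+1%:Z) = false by lia.
by have -> : k.+1%:Z - 1 = k by lia.
Qed.

Lemma monic_deriv_monic d P : P \is monic -> size P = d.+2 ->
  monic_deriv d.+1 P \is monic /\ size (monic_deriv d.+1 P) = d.+1.
Proof.
move=> /monicP; rewrite /lead_coef => P_lead P_size.
rewrite P_size /= in P_lead.
have coefd : (monic_deriv d.+1 P)`_d = 1.
  by rewrite coefZ coef_deriv P_lead mulVf // pnatr_eq0.
have sizeQ : size (monic_deriv d.+1 P) = d.+1.
  apply/eqP; rewrite eqn_leq; apply/andP; split.
    apply: (leq_trans (size_scale_leq _ _)).
    by rewrite -ltnS -P_size lt_size_deriv // -size_poly_gt0 P_size.
  by rewrite ltnNge; apply/negP => /leq_sizeP /(_ d (leqnn d)) /eqP;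
     rewrite coefd oner_eq0.
by split=> //; apply/monicP; rewrite /lead_coef sizeQ.
Qed.

Lemma monic_deriv_horner d P x :
  P^`().[x] = d.+1%:R * (monic_deriv d.+1 P).[x].
Proof. by rewrite hornerZ mulrA mulfV ?mul1r // pnatr_eq0. Qed.

(** The induction hypothesis. The gap of index [k] lies between the virtual
    roots [k] and [k.+1], so that [k = 0] and [k = d] are the two unbounded gaps; as
    the indices are natural numbers, the sign is an ordinary power. *)
Record vroots_split_sign d P : Prop := VrootsSplitSign {
  vroots_fin : forall k, (k < d)%N -> exists x, vroot d k.+1 P = x%:E;
  vroots_le : forall k, (vroot d k P <= vroot d k.+1 P)%E;
  vroots_sign : forall k x, (k <= d)%N ->
    (vroot d k P < x%:E < vroot d k.+1 P)%E -> 0 < (-1) ^+ (d + k) * P.[x]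
}.

(** The sign of [P'] on the [k]-th gap of [P' / (d + 1)] puts that gap in the
    domain of [calR]: for [k = 0] the parity [d + k] is the one required at
    [-oo], and for [k = d] it is even, as required at [+oo]. *)
Lemma vrootS_split_sign d k P : (0 < d)%N -> P \is monic -> size P = d.+2 ->
    vroots_split_sign d (monic_deriv d.+1 P) -> (k <= d)%N ->
  exists z, [/\ vroot d.+1 k.+1 P = z%:E,
    (vroot d k (monic_deriv d.+1 P) <= z%:E <=
       vroot d k.+1 (monic_deriv d.+1 P))%E,
    forall x, (vroot d k (monic_deriv d.+1 P) <= x%:E)%E -> x < z ->
      (-1) ^+ (d + k) * P.[x] < 0 &
    forall x, (x%:E <= vroot d k.+1 (monic_deriv d.+1 P))%E -> z < x ->
      0 < (-1) ^+ (d + k) * P.[x]].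
Proof.
move=> d_gt0 P_monic P_size [Q_fin Q_le Q_sign] kd.
rewrite vrootS //; apply: calR_split_sign => //.
- case: k kd => [|k] kd; first by rewrite vroot_le0.
  by have [x ->] := Q_fin k kd; exact: ltry.
- move: kd; rewrite leq_eqVlt => /predU1P[->|/Q_fin[x ->]].
    by rewrite vroot_gtd //; lia.
  by rewrite ltNyr.
- case: k kd => [|k kd]; last by have [x ->] := Q_fin k kd; rewrite ltNyr.
  by move=> _; have [x ->] := Q_fin 0 d_gt0; rewrite ltry orbT.
- case: k kd => [|k kd]; first by rewrite addn0.
  by have [x ->] := Q_fin k kd.
- move: kd; rewrite leq_eqVlt => /predU1P[->|/Q_fin[x ->]] //.
  by rewrite addnn odd_double.
- move=> x /(Q_sign _ _ kd) Q_gt0.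
  by rewrite (monic_deriv_horner d) mulrCA mulr_gt0 // ltr0n.
Qed.

Lemma vroots_interlace d P : (0 < d)%N -> P \is monic -> size P = d.+2 ->
    vroots_split_sign d (monic_deriv d.+1 P) ->
  forall k, (vroot d.+1 k P <= vroot d k (monic_deriv d.+1 P))%E /\
            (vroot d k (monic_deriv d.+1 P) <= vroot d.+1 k.+1 P)%E.
Proof.
move=> d_gt0 P_monic P_size Q_split k; split.
- case: k => [|k]; first by rewrite vroot_le0 // leNye.
  have [kd|dk] := leqP k d.
    have [z [-> /andP[]]] :=
      vrootS_split_sign _ _ _ d_gt0 P_monic P_size Q_split kd.
    by [].
  by rewrite [leRHS]vroot_gtd ?leey //; lia.
- have [kd|dk] := leqP k d.
    have [z [-> /andP[]]] :=
      vrootS_split_sign _ _ _ d_gt0 P_monic P_size Q_split kd.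
    by [].
  by rewrite [leRHS]vroot_gtd ?leey //; lia.
Qed.

Lemma vroots_split_sign1 P : P \is monic -> size P = 2 -> vroots_split_sign 1 P.
Proof.
move=> /monicP; rewrite /lead_coef => P_lead P_size.
rewrite P_size /= in P_lead.
have PE x : P.[x] = x + P`_0.
  by rewrite horner_coef P_size big_ord_recr big_ord1 /= P_lead; ring.
split=> [[|//] _|[|[|k]]|[|[|//]] x _].
- by exists (- P`_0).
- by rewrite vroot_le0 // leNye.
- by rewrite [leRHS]vroot_gtd // leey.
- by rewrite vroot_gtd.
- by rewrite /= lte_fin PE => /andP[_]; lra.
- by rewrite /= lte_fin PE => /andP[+ _]; lra.
Qed.

(** The [k]-th gap of [P] is cut by the virtual root [c] of index [k] of
    [P' / (d + 1)]. Beyond [c] it lies to the left of the minimizer taken on the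
    [k]-th gap of the derivative, and before [c] it lies to the right of the
    minimizer taken on the previous gap. *)
Lemma vroots_split_signP d P : (0 < d)%N -> P \is monic -> size P = d.+1 ->
  vroots_split_sign d P.
Proof.
elim: d P => // d IHd P _ P_monic P_size.
have [d0|d_gt0] := posnP d.
  by rewrite d0 in P_size *; exact: vroots_split_sign1.
have [Q_monic Q_size] := monic_deriv_monic _ _ P_monic P_size.
have Q_split := IHd _ d_gt0 Q_monic Q_size.
have spec := vrootS_split_sign _ _ _ d_gt0 P_monic P_size Q_split.
have interlace := vroots_interlace _ _ d_gt0 P_monic P_size Q_split.
split=> [k kd|k|k x kd /andP[kx xk]].
- by have [z [-> *]] := spec k kd; exists z.
- by have [] := interlace k; exact: le_trans.
- have [cx|xc] := leP (vroot d k (monic_deriv d.+1 P)) x%:E.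
  + (* For [k = d + 1] the separation [c] is [+oo], which excludes this case. *)
    have {}kd : (k <= d)%N.
      by rewrite leqNgt; apply/negP => dk; move: cx; rewrite vroot_gtd //; lia.
    have [z [zE _ neg _]] := spec k kd.
    rewrite zE lte_fin in xk.
    by have := neg x cx xk; rewrite addSn exprS mulN1r mulNr oppr_gt0.
  + case: k kd kx xk xc => [|k] kd kx xk xc; first by rewrite vroot_le0 in xc.
    have [z [zE _ _ pos]] := spec k kd.
    rewrite zE lte_fin in kx.
    have := pos x (ltW xc) kx.
    by rewrite addSn addnS !exprS mulrA mulrNN mulr1 mul1r.
Qed.

End VirtualRootsTheory.

Theorem proposition2p3 (R : realType) (d : nat) (P : {poly R})
    (d_gt0 : (0 < d)%N) (P_monic : P \is monic) (P_deg : size P = d.+1) :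
  [/\ forall r : int,
        (vroot d r P <= vroot d.-1 r (monic_deriv d P))%E /\
        (vroot d.-1 r (monic_deriv d P) <= vroot d (r + 1) P)%E,
      forall j : int, 1 <= j <= d%:Z -> exists x : R, vroot d j P = x%:E &
      forall (r : int) (x : R), vroot_gap d (r + 1) P x ->
        0 < (-1 : R) ^ (d%:Z + r) * P.[x] ].
Proof.
have [P_fin P_le P_sign] := vroots_split_signP _ _ _ d_gt0 P_monic P_deg.
have addS (k : nat) : k%:Z + 1 = k.+1 by lia.
split.
- case=> [k|k]; last by rewrite !vroot_le0 ?leNye //; lia.
  rewrite addS; case: d d_gt0 P_deg {P_fin P_le P_sign} => // d _ P_size.
  case: d P_size => [|d] P_size.
    by case: k => [|k];
       rewrite [vroot 0 _ _]/= ?leNye ?[vroot 1 k.+2 _]vroot_gtd // leey.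
  have [Q_monic Q_size] := monic_deriv_monic _ _ _ P_monic P_size.
  exact/vroots_interlace/vroots_split_signP.
- case=> [[|k]|k] // kd; apply: P_fin; lia.
- move=> [k|k] x; rewrite /vroot_gap /= addrK; last first.
    by rewrite [vroot d (_ + 1) _]vroot_le0 ?ltNge ?leNye ?andbF //; lia.
  rewrite addS => kx.
  have kd : (k <= d)%N.
    rewrite leqNgt; apply/negP => dk; move: kx.
    by rewrite vroot_gtd ?ltNge ?leey //; lia.
  by have := P_sign k x kd kx; rewrite exprnP PoszD.
Qed.
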